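(* Let $h>0$ and let $(\mathbf{x}^n,\mathbf{u}^{n+1/2})$ be a numerical solution of the explicit leapfrog method, i.e. for every step $n$ $$\mathbf{M}\bigl(\mathbf{u}^{n+1/2}-\mathbf{u}^{n-1/2}\bigr)=\tfrac h2\,\mathbf{F}(\mathbf{x}^n)\bigl(\mathbf{u}^{n+1/2}+\mathbf{u}^{n-1/2}\bigr),\qquad \mathbf{x}^{n+1}=\mathbf{x}^n+h\,\mathbf{u}^{n+1/2}.$$ Then the method preserves the mass shell $\mathcal{H}(\mathbf{u})=\tfrac12\mathbf{u}^\top\mathbf{M}\mathbf{u}$: for every such step, $$\mathcal{H}\bigl(\mathbf{u}^{n+1/2}\bigr)=\mathcal{H}\bigl(\mathbf{u}^{n-1/2}\bigr).$$
   Context: Let $\phi:\mathbb{R}^3\to\mathbb{R}$ (scalar potential) and $A:\mathbb{R}^3\to\mathbb{R}^3$ (vector potential) be arbitrarily differentiable, and let $E(x)=-\nabla\phi(x)$, $B(x)=\nabla\times A(x)$. Four-dimensional position vectors are written $\mathbf{x}=(t;x)\in\mathbb{R}\times\mathbb{R}^3$ (as column vectors), four-dimensional momentum vectors $\mathbf{u}=(\gamma;u)\in\mathbb{R}\times\mathbb{R}^3$. Let $\mathbf{M}=\mathrm{diag}(-1,1,1,1)$ and, for $\mathbf{x}=(t;x)$, $$\mathbf{F}(\mathbf{x})=\begin{pmatrix}0&-E(x)^\top\\ E(x)&-\widehat B(x)\end{pmatrix}\in\mathbb{R}^{4\times4},$$ where $\widehat B(x)$ is the $3\times3$ matrix with $\widehat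 B(x)v=B(x)\times v$ for all $v\in\mathbb{R}^3$; $\mathbf{F}(\mathbf{x})$ is skew-symmetric. The method discretizes $\mathbf{M}\ddot{\mathbf{x}}=\mathbf{F}(\mathbf{x})\dot{\mathbf{x}}$ with stepsize $h$. *)

(* Defs.v *)
From HB Require Import structures.
From mathcomp Require Import all_boot all_order all_algebra.
From mathcomp Require Import boolp classical_sets reals.
From mathcomp Require Import topology normedtype derive.

Set Implicit Arguments.
Unset Strict Implicit.
Unset Printing Implicit Defensive.

Import Order.TTheory GRing.Theory Num.Theory.
Import numFieldNormedType.Exports.

Local Open Scope ring_scope.

(* Every iterated directional derivative of f is Frechet differentiable at
   every point, i.e. f is differentiable infinitely often. *)
Definition smooth (R : realType) (n : nat) (V : normedModType R)
    (f : 'cV[R]_n.+1 -> V) : Prop :=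
  forall (vs : seq 'cV[R]_n.+1) (x : 'cV[R]_n.+1),
    differentiable (foldr (fun v g => (fun y => 'D_v g y)) f vs) x.

Section Fields.
Variable R : realType.

Definition partial (V : normedModType R) (i : 'I_3) (f : 'cV[R]_3 -> V)
    (x : 'cV[R]_3) : V :=
  'D_(delta_mx i 0) f x.

Definition grad (f : 'cV[R]_3 -> R) (x : 'cV[R]_3) : 'cV[R]_3 :=
  \col_i partial i f x.

(* In curl and cross, i + 1 and i + 2 are taken in 'I_3, hence modulo 3. *)
Definition curl (f : 'cV[R]_3 -> 'cV[R]_3) (x : 'cV[R]_3) : 'cV[R]_3 :=
  \col_(i < 3) (partial (i + 1) (fun y => f y (i + 2) 0) x
                - partial (i + 2) (fun y => f y (i + 1) 0) x).

Definition cross (v w : 'cV[R]_3) : 'cV[R]_3 :=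
  \col_(i < 3) (v (i + 1) 0 * w (i + 2) 0 - v (i + 2) 0 * w (i + 1) 0).

(* The matrix of the linear map v |-> cross b v in the standard basis. *)
Definition hat_mx (b : 'cV[R]_3) : 'M[R]_3 :=
  \matrix_(i, j) cross b (delta_mx j 0) i 0.

Lemma mul_hat_mx (b v : 'cV[R]_3) : hat_mx b *m v = cross b v.
Proof.
apply/colP => i; rewrite !mxE.
under eq_bigr => j _ do rewrite !mxE !eqxx !andbT mulrBl -!mulrA.
rewrite sumrB -!mulr_sumr; congr (_ * _ - _ * _).
  rewrite (bigD1 (i + 2)) //= eqxx mul1r big1 ?addr0 // => j.
  by rewrite eq_sym => /negPf ->; rewrite mul0r.
rewrite (bigD1 (i + 1)) //= eqxx mul1r big1 ?addr0 // => j.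
by rewrite eq_sym => /negPf ->; rewrite mul0r.
Qed.

Definition efield (phi : 'cV[R]_3 -> R) (x : 'cV[R]_3) : 'cV[R]_3 :=
  - grad phi x.

Definition bfield (A : 'cV[R]_3 -> 'cV[R]_3) (x : 'cV[R]_3) : 'cV[R]_3 :=
  curl A x.

(* Four-vectors (t; x) are columns of height 1 + 3; dsubmx is the part x. *)
Definition minkowski_mx : 'M[R]_(1 + 3) :=
  diag_mx (\row_i (if i == 0 then -1 else 1)).

Definition field_mx (phi : 'cV[R]_3 -> R) (A : 'cV[R]_3 -> 'cV[R]_3)
    (X : 'cV[R]_(1 + 3)) : 'M[R]_(1 + 3) :=
  let x := dsubmx X in
  block_mx 0 (- (efield phi x)^T) (efield phi x) (- hat_mx (bfield A x)).

Definition mass_shell (u : 'cV[R]_(1 + 3)) : R :=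
  2^-1 * (u^T *m minkowski_mx *m u) 0 0.

(* x n and u n stand for x^n and u^(n+1/2). *)
Definition leapfrog_step (phi : 'cV[R]_3 -> R) (A : 'cV[R]_3 -> 'cV[R]_3)
    (h : R) (x u : int -> 'cV[R]_(1 + 3)) (n : int) : Prop :=
  minkowski_mx *m (u n - u (n - 1))
    = (h / 2) *: (field_mx phi A (x n) *m (u n + u (n - 1)))
  /\ x (n + 1) = x n + h *: u n.

(* S is the set of steps that are carried out. It need not be all of int, or
   even infinite: the equation for u n can be singular, so that a solution
   need not extend to further steps. *)
Definition leapfrog_solution (phi : 'cV[R]_3 -> R)
    (A : 'cV[R]_3 -> 'cV[R]_3) (h : R) (S : set int)
    (x u : int -> 'cV[R]_(1 + 3)) : Prop :=
  forall n : int, S n -> leapfrog_step phi A h x u n.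

End Fields.

Arguments minkowski_mx {R}.

(* Main.v *)
(* Pairing the first leapfrog equation with u^(n+1/2) + u^(n-1/2) kills its
   right-hand side, since F is skew-symmetric, while by symmetry of M the
   left-hand side becomes twice the difference of the mass shells. *)
Require Import Defs.
From mathcomp Require Import all_boot all_order all_algebra.
From mathcomp Require Import boolp classical_sets reals.
From mathcomp Require Import topology normedtype derive.
Import Order.TTheory GRing.Theory Num.Theory.
Import numFieldNormedType.Exports.
Local Open Scope ring_scope.

(** A 1 x 1 matrix equals its transpose, while skewness of [K] makes the transpose the negative; in
    characteristic 0 this forces 0. *)
Lemma skew_quadratic_form_eq0 (R : numDomainType) (n : nat) (K : 'M[R]_n)
    (v : 'cV[R]_n) :
  K^T = - K -> v^T *m K *m v = 0.
Proof.
move=> skewK; apply/matrixP => i j; rewrite !ord1 [RHS]mxE.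
have : (v^T *m K *m v)^T = - (v^T *m K *m v).
  by rewrite !trmx_mul trmxK skewK mulNmx mulmxN mulmxA.
move=> /matrixP /(_ 0 0); rewrite mxE [RHS]mxE => /esym/eqP.
by rewrite eqNr => /eqP.
Qed.

Lemma sym_form_sumB (R : comNzRingType) (n : nat) (M : 'M[R]_n)
    (v w : 'cV[R]_n) :
  M^T = M ->
  (v + w)^T *m (M *m (v - w)) = v^T *m M *m v - w^T *m M *m w.
Proof.
move=> symM.
have vw : v^T *m M *m w = w^T *m M *m v.
  (* Being 1 x 1, the right-hand side may be replaced by its transpose. *)
  rewrite [RHS]mx11_scalar -tr_scalar_mx -mx11_scalar.
  by rewrite !trmx_mul trmxK symM mulmxA.
by rewrite linearD /= mulmxA !(mulmxDl, mulmxBr) vw addrKA.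
Qed.

Lemma hat_mx_skew (R : realType) (b : 'cV[R]_3) : (hat_mx b)^T = - hat_mx b.
Proof.
apply/matrixP => i j; rewrite !mxE !eqxx !andbT.
(* Nine entries are checked; indices such as [i + 2], reduced modulo 3, are compared by value. *)
by case: i j => [[|[|[|//]]] ?] [[|[|[|//]]] ?] /=;
  rewrite ?mulr0 ?mulr1 ?subr0 ?sub0r ?opprK ?oppr0 //;
  do ?congr (- _); congr (b _ 0); apply: val_inj.
Qed.

Lemma field_mx_skew (R : realType) (phi : 'cV[R]_3 -> R)
    (A : 'cV[R]_3 -> 'cV[R]_3) (X : 'cV[R]_(1 + 3)) :
  (field_mx phi A X)^T = - field_mx phi A X.
Proof.
rewrite /field_mx tr_block_mx opp_block_mx trmx0 oppr0 opprK.
by rewrite !linearN /= trmxK hat_mx_skew.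
Qed.

Theorem theorem3p1 (R : realType)
    (phi : 'cV[R]_3 -> R) (A : 'cV[R]_3 -> 'cV[R]_3)
    (phi_smooth : smooth phi) (A_smooth : smooth A)
    (h : R) (h_gt0 : 0 < h)
    (S : set int) (x u : int -> 'cV[R]_(1 + 3))
    (sol : leapfrog_solution phi A h S x u) :
  forall n : int, S n -> mass_shell (u n) = mass_shell (u (n - 1)).
Proof.
move=> n /sol [step _]; rewrite /mass_shell; congr (_ * _).
apply/eqP; rewrite -subr_eq0; apply/eqP.
(* The bracketing [M *m (v - w)] exposes the left-hand side of [step] for rewriting. *)
have := @sym_form_sumB _ _ minkowski_mx (u n) (u (n - 1)) (tr_diag_mx _).
rewrite step -scalemxAr mulmxA skew_quadratic_form_eq0; last exact: field_mx_skew.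
by rewrite scaler0 => /matrixP /(_ 0 0); rewrite !mxE => <-.
Qed.
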